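(* Let $b>0$, $\sigma>0$, $\alpha,\beta>-1$ and $\mu,\eta\in\mathbb{R}$. Define on $\Lambda=[0,b]$ \[ {}^1\mathcal{J}_n(x)=x^{\sigma(\beta-\eta-\mu)}P_n^{(\alpha,\beta)}\!\Big(2\big(\tfrac{x}{b}\big)^\sigma-1\Big),\qquad {}^2\mathcal{J}_n(x)=x^{\sigma\eta}(b^\sigma-x^\sigma)^\alpha P_n^{(\alpha,\beta)}\!\Big(2\big(\tfrac{x}{b}\big)^\sigma-1\Big), \] and the weights $w_1(x)=x^{\sigma(2(\eta+\mu)-\beta)}(b^\sigma-x^\sigma)^{\alpha}$, $w_2(x)=x^{\sigma(\beta-2\eta)}(b^\sigma-x^\sigma)^{-\alpha}$. Then $\{{}^1\mathcal{J}_n\}_{n=0}^\infty$ is a complete set in $\mathbf L^2_{x^{\sigma-1}w_1}(\Lambda)$ and $\{{}^2\mathcal{J}_n\}_{n=0}^\infty$ is a complete set in $\mathbf L^2_{x^{\sigma-1}w_2}(\Lambda)$.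
   Context: $P_n^{(\alpha,\beta)}$ is the classical Jacobi polynomial. For a positive weight $\omega$ on $\Lambda=[0,b]$, $\mathbf L^2_\omega(\Lambda)=\{u:\int_\Lambda u^2\omega\,dx<\infty\}$ with norm $\|u\|_\omega=(\int_\Lambda u^2\omega\,dx)^{1/2}$. Complete means the linear span is dense in the space. *)

(* Defs.v *)
From HB Require Import structures.
From mathcomp Require Import all_boot all_order all_algebra.
From mathcomp Require Import all_classical all_reals all_analysis.
Set Implicit Arguments. Unset Strict Implicit. Unset Printing Implicit Defensive.
Import Order.TTheory GRing.Theory Num.Theory.
Local Open Scope classical_set_scope.
Local Open Scope ring_scope.

Definition gbinom (R : realType) (a : R) (m : nat) : R :=
  (\prod_(i < m) (a - i%:R)) / (m`!)%:R.

(* classical Jacobi polynomial P_n^{(al,be)}(x) (Szego (4.3.2)) *)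
Definition jacobiP (R : realType) (al be : R) (n : nat) (x : R) : R :=
  \sum_(s < n.+1) gbinom (n%:R + al) (n - s) * gbinom (n%:R + be) s
                  * ((x - 1) / 2) ^+ s * ((x + 1) / 2) ^+ (n - s).

Definition itv0b (R : realType) (b : R) : set R := `[0, b]%classic.

Definition L2w (R : realType) (b : R) (w : R -> R) (u : R -> R) : Prop :=
  measurable_fun (itv0b b) u /\
  (\int[lebesgue_measure]_(x in (itv0b b)) ((u x) ^+ 2 * w x)%:E < +oo)%E.

Definition complete_in (R : realType) (b : R) (w : R -> R) (J : nat -> R -> R) : Prop :=
  (forall n, L2w b w (J n)) /\
  forall u, L2w b w u -> forall eps : R, 0 < eps ->
    exists (N : nat) (c : nat -> R),
      (\int[lebesgue_measure]_(x in (itv0b b))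
          ((u x - \sum_(k < N) c k * J k x) ^+ 2 * w x)%:E < eps%:E)%E.

(* Main.v *)
(** With t = (x/b)^sigma, both systems have the form J_n = g * q_n(t), where q_n
    is a polynomial of exact degree n and g^2 times the weight is
    rho = x^(sigma-1) (x^sigma)^be (b^sigma - x^sigma)^al, which is integrable on ]0, b[.
    Dividing by g, completeness becomes density of the polynomials in t in L^2(rho dx).
    Weierstrass' theorem is avoided: (1 - t^n)^m with m close to n / c^n is a
    bounded sequence of polynomials converging pointwise to the indicator of t < c; hence
    by dominated convergence the L^2(rho dx)-closure of the polynomials in t contains
    the indicators of ]-oo, x[, by Dynkin's lemma those of all Borel sets, and by
    simple functions everything. *)
Require Import Defs.
From HB Require Import structures.
From mathcomp Require Import all_boot all_order all_algebra.
From mathcomp Require Import all_classical all_reals all_analysis.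
From mathcomp Require Import measurable_realfun simple_functions measurable_fun_approximation.
From mathcomp Require Import ring lra.
Import Order.TTheory GRing.Theory Num.Theory.
Import numFieldNormedType.Exports.
Local Open Scope classical_set_scope.
Local Open Scope ring_scope.

(** * Weighted L^2 closure of the polynomials in [t] *)

Section WeightedSquare.
Context {d : measure_display} {T : measurableType d} {R : realType}.
Context (mu : {measure set T -> \bar R}) (D : set T) (rho t : T -> R).
Hypotheses (mD : measurable D) (mrho : measurable_fun D rho).
Hypothesis rho_ge0 : forall x, D x -> 0 <= rho x.
Hypothesis mt : measurable_fun D t.

(** The squared norm is kept without a square root, so Minkowski's inequality is replaced by the
    factor 2 of [le_wsqD]. *)
Definition wsq (f : T -> R) : \bar R :=
  (\int[mu]_(x in D) (f x ^+ 2 * rho x)%:E)%E.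

Definition poly_approx (f : T -> R) : Prop := forall eps : R, 0 < eps ->
  exists p : {poly R}, (wsq (fun x => f x - p.[t x])%R < eps%:E)%E.

Let ge0_integrand f x : D x -> (0 <= (f x ^+ 2 * rho x)%:E)%E.
Proof. by move=> Dx; rewrite lee_fin mulr_ge0 ?sqr_ge0 ?rho_ge0. Qed.

Let m_integrand (f : T -> R) : measurable_fun D f ->
  measurable_fun D (fun x => (f x ^+ 2 * rho x)%:E).
Proof.
move=> mf; apply/measurable_EFinP; apply: measurable_funM => //.
exact: measurable_funX.
Qed.

Lemma measurable_horner_comp (p : {poly R}) :
  measurable_fun D (fun x => p.[t x]).
Proof.
elim/poly_ind: p => [|p c IHp].
  by under eq_fun do rewrite horner0; exact: measurable_cst.
apply: (eq_measurable_fun (fun x => p.[t x] * t x + c)).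
  by move=> x _; rewrite hornerMXaddC.
by apply: measurable_funD => //; exact: measurable_funM.
Qed.

Lemma wsqZ (a : R) (f : T -> R) : measurable_fun D f ->
  wsq (fun x => a * f x) = ((a ^+ 2)%:E * wsq f)%E.
Proof.
move=> mf; rewrite /wsq -ge0_integralZl//; last 2 first.
- by move=> x; exact: ge0_integrand.
- by rewrite lee_fin sqr_ge0.
- by apply: eq_integral => x _; rewrite exprMn -mulrA EFinM.
- exact: m_integrand.
Qed.

(** Pointwise, [(f - g)^2 >= 0] gives [(f + g)^2 <= 2 (f^2 + g^2)]. *)
Lemma le_wsqD (f g : T -> R) : measurable_fun D f -> measurable_fun D g ->
  (wsq (fun x => f x + g x)%R <= 2%:E * (wsq f + wsq g))%E.
Proof.
move=> mf mg.
rewrite /wsq -ge0_integralD//; try exact: m_integrand; try exact: ge0_integrand.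
rewrite -ge0_integralZl//; last 2 first.
- by apply: emeasurable_funD; exact: m_integrand.
- by move=> x Dx; apply: adde_ge0; exact: ge0_integrand.
apply: ge0_le_integral => //.
- by move=> x; exact: (ge0_integrand (fun x => f x + g x)).
- by apply: m_integrand; exact: measurable_funD.
- by apply: emeasurable_funM => //; apply: emeasurable_funD; exact: m_integrand.
move=> x Dx; rewrite -EFinD -EFinM lee_fin.
have := rho_ge0 x Dx; have := sqr_ge0 (f x - g x) => h r0.
rewrite -mulrDl mulrA ler_wpM2r//; nra.
Qed.

(** The closure is closed. Two errors below [eps / 4] add up to less than [eps / 2], and [le_wsqD]
    doubles this. *)
Lemma poly_approx_trans (f : T -> R) : measurable_fun D f ->
  (forall eps : R, 0 < eps -> exists g : T -> R,
    [/\ measurable_fun D g, poly_approx g &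
        (wsq (fun x => f x - g x)%R < eps%:E)%E]) ->
  poly_approx f.
Proof.
move=> mf H eps eps0; have e4 : 0 < eps / 4 by lra.
have [g [mg ag fg]] := H _ e4; have [p gp] := ag _ e4.
exists p.
rewrite [X in wsq X](_ : _ = fun x => (f x - g x) + (g x - p.[t x])); last first.
  by apply/funext => x; ring.
apply: le_lt_trans.
  by apply: le_wsqD; apply: measurable_funB => //; exact: measurable_horner_comp.
rewrite (_ : eps%:E = (2%:E * ((eps / 4)%:E + (eps / 4)%:E))%E); last first.
  by rewrite -EFinD -EFinM; congr EFin; lra.
by rewrite lte_pmul2l// lteD.
Qed.

Lemma poly_approxD (f g : T -> R) : measurable_fun D f -> measurable_fun D g ->
  poly_approx f -> poly_approx g -> poly_approx (fun x => f x + g x).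
Proof.
move=> mf mg af ag eps eps0; have e4 : 0 < eps / 4 by lra.
have [p fp] := af _ e4; have [q gq] := ag _ e4.
exists (p + q).
rewrite [X in wsq X](_ : _ = fun x => (f x - p.[t x]) + (g x - q.[t x])); last first.
  by apply/funext => x; rewrite hornerD; ring.
apply: le_lt_trans.
  by apply: le_wsqD; apply: measurable_funB => //; exact: measurable_horner_comp.
rewrite (_ : eps%:E = (2%:E * ((eps / 4)%:E + (eps / 4)%:E))%E); last first.
  by rewrite -EFinD -EFinM; congr EFin; lra.
by rewrite lte_pmul2l// lteD.
Qed.

Lemma poly_approxZ (a : R) (f : T -> R) : measurable_fun D f ->
  poly_approx f -> poly_approx (fun x => a * f x).
Proof.
move=> mf af eps eps0.
(* Dividing by [a ^+ 2 + 1] instead of [a ^+ 2] covers the case [a = 0]. *)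
have a1 : 0 < a ^+ 2 + 1 by rewrite ltr_wpDl ?sqr_ge0.
have [p fp] := af _ (divr_gt0 eps0 a1).
exists (a *: p).
rewrite [X in wsq X](_ : _ = fun x => a * (f x - p.[t x])); last first.
  by apply/funext => x; rewrite hornerZ; ring.
rewrite wsqZ; last first.
  by apply: measurable_funB => //; exact: measurable_horner_comp.
apply: (@le_lt_trans _ _ ((a ^+ 2 + 1)%:E * wsq (fun x => f x - p.[t x])%R)%E).
  apply: lee_wpmul2r; first by apply: integral_ge0 => x; exact: (ge0_integrand (fun x => f x - p.[t x])).
  by rewrite lee_fin lerDl.
by rewrite -lte_pdivlMl// -EFinM mulrC.
Qed.

Lemma poly_approx_poly (p : {poly R}) : poly_approx (fun x => p.[t x]).
Proof.
move=> eps eps0; exists p; rewrite /wsq.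
under eq_integral do rewrite subrr expr0n mul0r.
by rewrite integral0 lte_fin.
Qed.

Lemma poly_approx_eq (f g : T -> R) : {in D, f =1 g} -> poly_approx f -> poly_approx g.
Proof.
move=> fg af eps eps0; have [p fp] := af _ eps0; exists p.
by congr (_ < _)%E: fp; apply: eq_integral => x Dx; rewrite fg.
Qed.

(** Dominated convergence for the squared errors, with the integrable bound [h^2 rho], gives norm
    convergence; then the closure is closed. *)
Lemma poly_approx_lim (f_ : nat -> T -> R) (f h : T -> R) :
  (forall n, measurable_fun D (f_ n)) -> measurable_fun D f ->
  measurable_fun D h -> (wsq h < +oo)%E ->
  (forall n x, D x -> `|f x - f_ n x| <= h x) ->
  (forall x, D x -> f_ n x @[n --> \oo] --> f x) ->
  (forall n, poly_approx (f_ n)) -> poly_approx f.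
Proof.
move=> mf_ mf mh hoo fh f_f af_; apply: poly_approx_trans => // eps eps0.
pose F n x := ((f x - f_ n x) ^+ 2 * rho x)%:E.
pose G x := (h x ^+ 2 * rho x)%:E.
have [|||||_ _] := @dominated_convergence _ _ _ mu D mD F (cst 0%E) G.
- by move=> n; apply: m_integrand; exact: measurable_funB.
- exact: measurable_cst.
- apply: aeW => x Dx; rewrite /F; apply: cvg_EFin; first exact: nearW.
  rewrite (_ : 0 = (f x - f x) ^+ 2 * rho x); last by rewrite subrr expr0n mul0r.
  have c : f x - f_ n x @[n --> \oo] --> f x - f x.
    by apply: cvgB; [exact: cvg_cst|exact: f_f].
  apply: cvgM; last exact: cvg_cst.
  by rewrite expr2; under eq_fun do rewrite expr2; exact: cvgM.
- apply/integrableP; split; first exact: m_integrand.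
  by under eq_integral => x /set_mem Dx do rewrite gee0_abs ?ge0_integrand//.
- apply: aeW => x n Dx; rewrite /F /G gee0_abs ?(ge0_integrand (fun x => f x - f_ n x))//.
  rewrite lee_fin ler_wpM2r ?rho_ge0// -real_normK ?num_real//.
  by rewrite lerXn2r ?nnegrE ?normr_ge0 ?(le_trans _ (fh n x Dx))// fh.
(* The integrals tend to 0 in the extended reals: they are eventually finite, and eventually below
   [eps]. One index with both properties suffices. *)
rewrite integral0 => /fine_cvgP[Ffin /cvgrPdist_lt /(_ _ eps0) Feps].
have [n _ /(_ n (leqnn n))[/= nfin neps]] := filterI Ffin Feps.
exists (f_ n); split => //.
have ge0 : (0 <= \int[mu]_(x in D) F n x)%E.
  by apply: integral_ge0 => x; exact: (ge0_integrand (fun x => f x - f_ n x)).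
rewrite -[wsq _]/(\int[mu]_(x in D) F n x)%E -(fineK nfin) lte_fin.
by move: neps; rewrite sub0r normrN ger0_norm// fine_ge0.
Qed.


Hypothesis rho_fin : (\int[mu]_(x in D) (rho x)%:E < +oo)%E.

Lemma wsq_cst_fin (a : R) : (wsq (cst a) < +oo)%E.
Proof.
rewrite /wsq /cst; under eq_integral do rewrite EFinM.
rewrite ge0_integralZl ?lee_fin ?sqr_ge0//.
  by rewrite lte_mul_pinfty ?lee_fin ?sqr_ge0.
exact/measurable_EFinP.
Qed.

Lemma poly_approx_lim1 (f_ : nat -> T -> R) (f : T -> R) :
  (forall n, measurable_fun D (f_ n)) -> measurable_fun D f ->
  (forall n x, D x -> 0 <= f_ n x <= 1) -> (forall x, D x -> 0 <= f x <= 1) ->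
  (forall x, D x -> f_ n x @[n --> \oo] --> f x) ->
  (forall n, poly_approx (f_ n)) -> poly_approx f.
Proof.
move=> mf_ mf f_01 f01 f_f; apply: (poly_approx_lim _ _ (cst 1)) => //.
  exact: wsq_cst_fin.
move=> n x Dx; rewrite ler_norml /cst.
by move: (f_01 n x Dx) (f01 x Dx) => /andP[? ?] /andP[? ?]; apply/andP; split; lra.
Qed.

(** The sets whose indicator is approximable form a Dynkin system: complements by linearity,
    disjoint countable unions by bounded convergence. A generating pi-system then yields all
    measurable sets. *)
Lemma poly_approx_indic_gen (G : set (set T)) :
  @measurable _ T = <<s G >> -> setI_closed G ->
  (forall A, G A -> poly_approx (\1_A)) ->
  forall A, measurable A -> poly_approx (\1_A).
Proof.
move=> mG GI GP A; rewrite mG.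
apply: (@dynkin_induction _ _ _ (fun A => poly_approx (\1_A))) => //.
- apply: (poly_approx_eq _ _ _ (poly_approx_poly 1)) => x _.
  by rewrite hornerE indicT.
- move=> S mS aS.
  apply: (poly_approx_eq (fun x => (1 : {poly R}).[t x] + -1 * \1_S x)).
    move=> x _; rewrite hornerE !indicE in_setC mulN1r.
    by case: (x \in S); rewrite ?subrr ?subr0.
  apply: poly_approxD; last 2 first.
  + exact: poly_approx_poly.
  + by apply: poly_approxZ => //; exact/measurable_funTS/measurable_indic.
  + exact: measurable_horner_comp.
  + by apply: measurable_funM => //; exact/measurable_funTS/measurable_indic.
- move=> F mF tF aF.
  have mU n : measurable (\bigcup_(k in `I_n) F k) by apply: bigcup_measurable.
  apply: (poly_approx_lim1 (fun n => \1_(\bigcup_(k in `I_n) F k))).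
  + by move=> n; exact/measurable_funTS/measurable_indic.
  + by apply/measurable_funTS/measurable_indic; exact: bigcup_measurable.
  + by move=> n x _; rewrite indicE ler0n lern1 leq_b1.
  + by move=> x _; rewrite indicE ler0n lern1 leq_b1.
  (* The indicators of the partial unions are eventually constant at each point. *)
  + move=> x _; rewrite !indicE.
    have [/set_mem[k _ Fkx]|xF] := boolP (x \in \bigcup_k F k).
      apply: cvg_near_cst; exists k.+1 => // n /= kn.
      by rewrite indicE mem_set//; exists k.
    apply: cvg_near_cst; apply: nearW => n.
    rewrite indicE memNset// => -[k _ Fkx].
    by move/negP: xF; apply; apply/mem_set; exists k.
  (* Disjointness makes the indicator of a finite union the sum of the indicators. *)
  + elim=> [|n IHn].
      apply: (poly_approx_eq _ _ _ (poly_approx_poly 0)) => x _.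
      by rewrite horner0 II0 bigcup_set0 indic0.
    apply: (poly_approx_eq (fun x => \1_(\bigcup_(k in `I_n) F k) x + \1_(F n) x)).
      move=> x _; rewrite IIS setUC bigcup_setU1 setUC !indicE in_setU.
      have [/set_mem[k /= kn Fkx]|_] := boolP (x \in \bigcup_(k in `I_n) F k).
        rewrite memNset ?addr0// => Fnx.
        by move: kn; rewrite (tF k n _ _ _)//= ?ltnn//; exists x.
      by rewrite add0r.
    by apply: poly_approxD => //; exact/measurable_funTS/measurable_indic.
Qed.

Hypothesis indic_approx : forall A, measurable A -> poly_approx (\1_A).

Import HBNNSimple.

Lemma poly_approx_nnsfun (f : {nnsfun T >-> R}) : poly_approx f.
Proof.
(* The finite range of [f] is generalised to an arbitrary list of values, which makes induction
   possible. *)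
suff H (s : seq R) : poly_approx (fun x => \sum_(y <- s) y * \1_(f @^-1` [set y]) x).
  by apply: poly_approx_eq (H _) => x _; rewrite fimfunE fsbig_finite.
elim: s => [|y s IHs].
  by apply: (poly_approx_eq _ _ _ (poly_approx_poly 0)) => x _; rewrite big_nil horner0.
apply: (poly_approx_eq
  (fun x => y * \1_(f @^-1` [set y]) x + \sum_(z <- s) z * \1_(f @^-1` [set z]) x)).
  by move=> x _; rewrite big_cons.
have m1 z : measurable_fun D (\1_(f @^-1` [set z]) : T -> R).
  exact/measurable_funTS/measurable_indic/measurable_funPTI.
apply: poly_approxD => //.
- exact: measurable_funM.
- by apply: measurable_sum => z; exact: measurable_funM.
- by apply: poly_approxZ => //; exact/indic_approx/measurable_funPTI.
Qed.

(** Simple functions increase to [f] from below, so the errors are dominated by [f] itself. *)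
Lemma poly_approx_ge0 (f : T -> R) : measurable_fun D f ->
  (forall x, D x -> 0 <= f x) -> (wsq f < +oo)%E -> poly_approx f.
Proof.
move=> mf f0 foo.
have mEf : measurable_fun D (EFin \o f) by exact/measurable_EFinP.
have Ef0 x : D x -> (0 <= (EFin \o f) x)%E by move=> Dx; rewrite lee_fin f0.
pose g := nnsfun_approx mD mEf.
have gf n x : D x -> g n x <= f x.
  by move=> Dx; rewrite -lee_fin /g nnsfun_approxE; exact: le_approx.
apply: (poly_approx_lim g f f) => //.
- by move=> n; exact/measurable_funTS.
- by move=> n x Dx; rewrite ger0_norm ?subr_ge0 ?gf// lerBlDr lerDl.
- move=> x Dx; have := cvg_nnsfun_approx mD mEf Ef0 Dx.
  by move=> /fine_cvgP[].
- by move=> n; exact: poly_approx_nnsfun.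
Qed.

Lemma poly_approx_L2 (f : T -> R) : measurable_fun D f ->
  (wsq f < +oo)%E -> poly_approx f.
Proof.
move=> mf foo.
(* Both the positive and the negative part of [f] lie between 0 and its absolute value, hence
   inherit square integrability. *)
have pos (g : T -> R) : measurable_fun D g -> (forall x, 0 <= g x <= `|f x|) ->
    poly_approx g.
  move=> mg g0; apply: poly_approx_ge0 => //; first by move=> x _; case/andP: (g0 x).
  apply: le_lt_trans foo; apply: ge0_le_integral => //.
  + by move=> x; exact: ge0_integrand.
  + exact: m_integrand.
  + exact: m_integrand.
  move=> x Dx; rewrite lee_fin ler_wpM2r ?rho_ge0// -(real_normK (num_real (f x))).
  by case/andP: (g0 x) => ? ?; rewrite lerXn2r ?nnegrE.
apply: (poly_approx_eq (fun x => f^\+ x + -1 * f^\- x)).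
  by move=> x _; rewrite -[in RHS](funrposBneg f) mulN1r.
have m1 : measurable_fun D f^\+ by exact: measurable_funrpos.
have m2 : measurable_fun D f^\- by exact: measurable_funrneg.
apply: poly_approxD => //.
- exact: measurable_funM.
- apply: pos => // x; rewrite funrpos_ge0/= /funrpos.
  by rewrite ge_max ler_norm normr_ge0.
- apply: poly_approxZ => //; apply: pos => // x; rewrite funrneg_ge0/= /funrneg.
  by rewrite ge_max ler_normr lexx orbT normr_ge0.
Qed.
End WeightedSquare.

(** * Bounded polynomials converging to a step function *)

Lemma bernoulli_ler (R : realDomainType) (y : R) (n : nat) :
  -1 <= y -> 1 + n%:R * y <= (1 + y) ^+ n.
Proof.
move=> y1; elim: n => [|n IHn]; first by rewrite mul0r addr0 expr0.
have y1' : 0 <= 1 + y by lra.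
rewrite exprS; apply: le_trans (ler_wpM2l y1' IHn).
have : 0 <= n%:R * y ^+ 2 :> R by rewrite mulr_ge0 ?sqr_ge0.
rewrite -natr1; nra.
Qed.

(** Write [q = r^2]: since [n r^n] stays below [1 / (1 - r)], the sequence is dominated by the
    geometric sequence [r^n / (1 - r)]. *)
Lemma cvg_nat_geometric (R : realType) (q : R) : 0 <= q < 1 ->
  n%:R * q ^+ n @[n --> \oo] --> (0 : R).
Proof.
move=> /andP[q0 q1]; pose r := Num.sqrt q.
have r0 : 0 <= r := sqrtr_ge0 _.
have rq : r ^+ 2 = q by rewrite sqr_sqrtr.
have r1 : r < 1.
  by rewrite -(@ltr_pXn2r _ 2)// ?nnegrE// rq expr1n.
(* Each of the [n] terms of [1 + r + ... + r^(n-1)] is at least [r^n]. *)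
have rn n : n%:R * r ^+ n * (1 - r) <= 1 - r ^+ n.
  elim: n => [|n IHn]; first by rewrite !mul0r expr0 subrr.
  have rn0 : 0 <= r ^+ n by exact: exprn_ge0.
  have : r ^+ n <= 1 by rewrite exprn_ile1// ltW.
  rewrite exprS -natr1; move: IHn; set a := r ^+ n => IHn a1.
  have -> : (n%:R + 1) * (r * a) * (1 - r) =
    r * (n%:R * a * (1 - r)) + r * a * (1 - r) by ring.
  have := ler_wpM2l r0 IHn.
  have : 0 <= (1 - r) * (1 - r * a) by apply: mulr_ge0; nra.
  nra.
apply: (@squeeze_cvgr _ _ _ _ (cst 0) (fun n => (1 - r)^-1 * r ^+ n)).
- apply: nearW => n; rewrite mulr_ge0 ?exprn_ge0//=.
  rewrite -rq -exprM mulnC exprM expr2 mulrA ler_wpM2r ?exprn_ge0//.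
  rewrite -[leRHS]mul1r ler_pdivlMr ?subr_gt0//.
  by apply: le_trans (rn n) _; rewrite lerBlDr lerDl exprn_ge0.
- exact: cvg_cst.
- rewrite -[X in _ --> X](mulr0 (1 - r)^-1); apply: cvgM; first exact: cvg_cst.
  by apply: cvg_expr; rewrite ger0_norm.
Qed.

(* [(1 - s^n)^m] with [m] close to [n / c^n] jumps from 1 to 0 as [s] crosses [c]. *)
Lemma cvg_step_poly (R : realType) (c s : R) : 0 < c -> 0 <= s <= 1 ->
  (1 - s ^+ n) ^+ Num.truncn (n%:R / c ^+ n : R) @[n --> \oo] --> ((s < c)%R%:R : R).
Proof.
move=> c0 /andP[s0 s1].
have sn n : 0 <= s ^+ n <= 1 by rewrite exprn_ge0// exprn_ile1.
have tn n : 0 <= n%:R / c ^+ n by rewrite divr_ge0 ?exprn_ge0 ?(ltW c0).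
have mc n : (Num.truncn (n%:R / c ^+ n))%:R <= n%:R / c ^+ n.
  by case/andP: (truncn_itv (tn n)).
have cm n : n%:R / c ^+ n < (Num.truncn (n%:R / c ^+ n)).+1%:R.
  by case/andP: (truncn_itv (tn n)).
have [sc|cs] := ltP s c.
(* Below the jump: Bernoulli gives [(1 - s^n)^m >= 1 - m s^n], and [m <= n / c^n]. *)
- apply: (@squeeze_cvgr _ _ _ _ (fun n => 1 - n%:R * (s / c) ^+ n) (cst 1)).
  + apply: nearW => n; case/andP: (sn n) => sn0 sn1; apply/andP; split; last first.
      by rewrite exprn_ile1//; lra.
    apply: (le_trans _ (@bernoulli_ler _ (- s ^+ n) _ _)); last lra.
    rewrite mulrN lerD2l lerN2 expr_div_n mulrA [leRHS]mulrAC.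
    by rewrite ler_wpM2r.
  + rewrite -[X in _ --> X]subr0; apply: cvgB; first exact: cvg_cst.
    by apply: cvg_nat_geometric; rewrite divr_ge0 ?(ltW c0)//= ltr_pdivrMr// mul1r.
  + exact: cvg_cst.
(* At or above the jump: [m + 1 > n / c^n] and Bernoulli give [n <= 1 + m s^n <= (1 + s^n)^m], while
   [(1 - s^n)^m (1 + s^n)^m <= 1]. So [a = (1 - s^n)^m] satisfies [a n <= 1] and [a <= 1], whence
   [a <= 2 / (n + 1)]. *)
- apply: (@squeeze_cvgr _ _ _ _ (cst 0) (fun n => 2 * harmonic n)).
  + apply: nearW => n; case/andP: (sn n) => sn0 sn1.
    set m := Num.truncn _.
    have a0 : 0 <= (1 - s ^+ n) ^+ m by rewrite exprn_ge0 ?subr_ge0.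
    have a1 : (1 - s ^+ n) ^+ m <= 1 by rewrite exprn_ile1 ?subr_ge0// lerBlDr lerDl.
    rewrite a0 /harmonic/= ler_pdivlMr// -natr1.
    have : (1 - s ^+ n) ^+ m * n%:R <= 1.
      have := @bernoulli_ler _ (s ^+ n) m ltac:(lra).
      have nm : n%:R <= 1 + m%:R * s ^+ n.
        have : n%:R <= (m%:R + 1) * s ^+ n.
          rewrite natr1; apply: le_trans (ler_wpM2r sn0 (ltW (cm n))).
          rewrite -mulrA ler_peMr// mulrC ler_pdivlMr ?exprn_gt0// mul1r.
          by rewrite lerXn2r ?nnegrE// ltW.
        by rewrite mulrDl mul1r; lra.
      move=> bm; apply: le_trans (ler_wpM2l a0 (le_trans nm bm)) _.
      rewrite -exprMn -subr_sqr expr1n exprn_ile1// ?subr_ge0 ?exprn_ile1//.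
      by rewrite lerBlDr lerDl sqr_ge0.
    lra.
  + exact: cvg_cst.
  + rewrite -[X in _ --> X](mulr0 2); apply: cvgM; first exact: cvg_cst.
    exact: cvg_harmonic.
Qed.

(** * Integrability of the Jacobi weight *)

(** The open interval is exhausted by compact ones. On each, the fundamental theorem of calculus
    bounds the integral by [2 M], and monotone convergence passes to the limit. *)
Lemma ge0_integral_oo_fin (R : realType) (f F : R -> R) (a b M : R) : a < b ->
  (forall x, a < x < b -> 0 <= f x) ->
  (forall x, a < x < b -> {for x, continuous f}) ->
  (forall x : R, a < x < b -> is_derive x (1:R) F (f x)) ->
  (forall x, a < x < b -> `|F x| <= M) ->
  (\int[lebesgue_measure]_(x in `]a, b[) (f x)%:E < +oo)%E.
Proof.
move=> ab f0 cf dF FM.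
(* As [harmonic 0] is 1, the third keeps [a + d n < b - d n] from [n = 0] on. *)
pose d n : R := (b - a) / 3 * harmonic n.
have d0 n : 0 < d n by rewrite /d mulr_gt0 ?divr_gt0 ?subr_gt0// /harmonic/= invr_gt0.
have dle m n : (m <= n)%N -> d n <= d m.
  move=> mn; rewrite /d ler_wpM2l//; first by rewrite divr_ge0// subr_ge0 ltW.
  by rewrite /harmonic/= lef_pV2 ?posrE// ler_nat.
have d3 n : d n <= (b - a) / 3.
  rewrite /d ler_piMr//; first by rewrite divr_ge0// subr_ge0 ltW.
  by rewrite /harmonic/= invf_le1// ler1n.
pose I n : set R := `[a + d n, b - d n]%classic.
have IE : \bigcup_n I n = `]a, b[%classic.
  apply/seteqP; split=> [x [n _]|x].
    by rewrite /I/= !in_itv/= => /andP[? ?]; have := d0 n => ?; apply/andP; split; lra.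
  rewrite /= in_itv/= => /andP[ax xb].
  have : d n @[n --> \oo] --> (0 : R).
    rewrite -[X in _ --> X](mulr0 ((b - a) / 3)).
    by apply: cvgM; [exact: cvg_cst|exact: cvg_harmonic].
  have e0 : 0 < Num.min (x - a) (b - x) by rewrite lt_min !subr_gt0 ax.
  move=> /cvgrPdist_lt /(_ _ e0)[n _ /(_ n (leqnn n))] /=.
  rewrite sub0r normrN ger0_norm ?(ltW (d0 n))// lt_min => /andP[? ?].
  by exists n => //; rewrite /I/= in_itv/=; apply/andP; split; lra.
have Iab n x : I n x -> a < x < b.
  by rewrite /I/= in_itv/= => /andP[? ?]; have := d0 n => ?; apply/andP; split; lra.
have cF x : a < x < b -> {for x, continuous F}.
  move=> xab; apply: differentiable_continuous; apply/derivable1_diffP.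
  by have [] := dF x xab.
have : (\int[lebesgue_measure]_(x in I n) (f x)%:E)%E @[n --> \oo] -->
    (\int[lebesgue_measure]_(x in \bigcup_n I n) (f x)%:E)%E.
  apply: ge0_nondecreasing_set_cvg_integral.
  - move=> m n mn; apply/subsetPset => x; rewrite /I/= !in_itv/= => /andP[? ?].
    by have := dle _ _ mn => ?; apply/andP; split; lra.
  - by move=> n; exact: measurable_itv.
  - move=> n; apply: (@measurable_funS _ _ _ _ `]a, b[%classic) => //.
      by move=> x /Iab; rewrite /= in_itv.
    apply/measurable_EFinP; apply: open_continuous_measurable_fun; first exact: itv_open.
    by move=> x /set_mem; rewrite /= in_itv/=; exact: cf.
  - by move=> n x /Iab xab; rewrite lee_fin f0.
rewrite IE => cvI; apply: (@le_lt_trans _ _ (2 * M)%:E); last exact: ltry.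
apply: cvge_le cvI; apply: nearW => n.
have an : a < a + d n < b by have := d0 n; have := d3 n => ? ?; apply/andP; split; lra.
have bn : a < b - d n < b by have := d0 n; have := d3 n => ? ?; apply/andP; split; lra.
rewrite (@continuous_FTC2 _ f F).
- rewrite -EFinB lee_fin; have := FM _ an; have := FM _ bn.
  by rewrite !ler_norml => /andP[? ?] /andP[? ?]; lra.
- by have := d0 n; have := d3 n => ? ?; lra.
- apply: continuous_in_subspaceT => x /set_mem /Iab; exact: cf.
- split.
  + move=> x xI; have : a < x < b by apply: (Iab n); exact: subset_itv_oo_cc xI.
    by move=> /dF[].
  + by apply: cvg_at_right_filter; exact: cF.
  + by apply: cvg_at_left_filter; exact: cF.
- move=> x xI; have : a < x < b by apply: (Iab n); exact: subset_itv_oo_cc xI.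
  by move=> /dF[_ <-]; rewrite derive1E.
Qed.

Lemma continuous_powR_gt0 (R : realType) (p x : R) : 0 < x ->
  {for x, continuous (@powR R ^~ p)}.
Proof.
move=> x0; apply: differentiable_continuous; apply/derivable1_diffP.
by have [] := is_derive1_powR p x0.
Qed.

(** A power is monotone in its base, so one of the endpoint values is a bound; their sum serves both
    signs of [a]. *)
Lemma powR_le_half (R : realType) (B a z : R) : 0 < B -> B / 2 <= z <= B ->
  z `^ a <= B `^ a + (B / 2) `^ a.
Proof.
move=> B0 /andP[Bz zB]; have z0 : 0 < z by lra.
have B2 : 0 < B / 2 by lra.
have [a0|a0] := leP 0 a.
  apply: ler_wpDr; first exact: powR_ge0.
  by rewrite ge0_ler_powR ?nnegrE ?(ltW z0) ?(ltW B0).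
apply: ler_wpDl; first exact: powR_ge0.
rewrite -[a]opprK powRN [leRHS]powRN lef_pV2 ?posrE ?powR_gt0//.
by rewrite ge0_ler_powR ?nnegrE ?oppr_ge0 ?(ltW a0) ?(ltW z0) ?(ltW B2).
Qed.

(** On each half of the interval one of the two factors is bounded. Replacing the product by a sum
    separates the two endpoint singularities. *)
Lemma beta_weight_le (R : realType) (B a c : R) : 0 < B ->
  exists K : R, 0 <= K /\ forall y, 0 < y < B ->
    y `^ a * (B - y) `^ c <= K * (y `^ a + (B - y) `^ c).
Proof.
move=> B0; pose k (e : R) := B `^ e + (B / 2) `^ e.
have k0 e : 0 <= k e by rewrite addr_ge0 ?powR_ge0.
exists (k a + k c); split; first by rewrite addr_ge0.
move=> y /andP[y0 yB].
have := powR_ge0 y a; have := powR_ge0 (B - y) c; have := k0 a; have := k0 c.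
have [yh|yh] := leP y (B / 2).
  have := @powR_le_half _ B c (B - y) B0 ltac:(apply/andP; split; lra).
  rewrite -/(k c); move: (k a) (k c) (y `^ a) ((B - y) `^ c) => *; nra.
have := @powR_le_half _ B a y B0 ltac:(apply/andP; split; lra).
rewrite -/(k a); move: (k a) (k c) (y `^ a) ((B - y) `^ c) => *; nra.
Qed.

Section JacobiWeight.
Context {R : realType} (b sigma al be : R).
Hypotheses (hb : 0 < b) (hsigma : 0 < sigma) (hal : -1 < al) (hbe : -1 < be).

(** Up to a constant, this is the pullback of the classical measure [(1 - z)^al (1 + z)^be dz] along
    [z = 2 (x / b)^sigma - 1]. *)
Definition jacobi_weight (x : R) : R :=
  x `^ (sigma - 1) * ((x `^ sigma) `^ be * (b `^ sigma - x `^ sigma) `^ al).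

Lemma jacobi_weight_ge0 x : 0 <= jacobi_weight x.
Proof. by rewrite !mulr_ge0 ?powR_ge0. Qed.

Lemma measurable_jacobi_weight D : measurable_fun D jacobi_weight.
Proof.
apply: measurable_funTS; apply: measurable_funM => //.
have ms : measurable_fun setT (@powR R ^~ sigma) by exact: measurable_powR.
apply: measurable_funM.
  exact: (measurableT_comp (measurable_powR _)).
by apply: (measurableT_comp (measurable_powR _)); exact: measurable_funB.
Qed.

Let powR_itv x : 0 < x < b -> 0 < x `^ sigma < b `^ sigma.
Proof.
move=> /andP[x0 xb]; rewrite powR_gt0//= gt0_ltr_powR ?nnegrE ?ltW//.
Qed.

(** The antiderivative [x^s / s] is bounded because [be > -1] makes [s = sigma (be + 1)]
    positive. *)
Let integral_left :
  (\int[lebesgue_measure]_(x in `]0%R, b[) (x `^ (sigma * (be + 1) - 1))%:E < +oo)%E.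
Proof.
have s0 : 0 < sigma * (be + 1) by rewrite mulr_gt0// -ltrBlDr sub0r.
set s := sigma * (be + 1) in s0 *.
apply: (@ge0_integral_oo_fin _ _ (fun x => s^-1 * x `^ s) _ _ (s^-1 * b `^ s)) => //.
- by move=> x _; exact: powR_ge0.
- by move=> x /andP[x0 _]; exact: continuous_powR_gt0.
- move=> x /andP[x0 _].
  rewrite (_ : _ `^ (s - 1) = s^-1 *: (s * x `^ (s - 1))); last first.
    by rewrite scalerA mulVf ?gt_eqF// scale1r.
  by apply: is_deriveZ; exact: is_derive1_powR.
- move=> x /andP[x0 xb]; rewrite ger0_norm; last by rewrite mulr_ge0 ?powR_ge0 ?invr_ge0 ?ltW.
  by rewrite ler_pM2l ?invr_gt0// ge0_ler_powR ?nnegrE ?ltW.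
Qed.

(** The factor [x^(sigma - 1)] is the derivative of [x^sigma] up to a constant, so a multiple of
    [(b^sigma - x^sigma)^(al + 1)] is an antiderivative, bounded as [al > -1]. *)
Let integral_right :
  (\int[lebesgue_measure]_(x in `]0%R, b[)
     (x `^ (sigma - 1) * (b `^ sigma - x `^ sigma) `^ al)%:E < +oo)%E.
Proof.
have s0 : 0 < al + 1 by rewrite -ltrBlDr sub0r.
set s := al + 1 in s0 *.
pose c := (sigma * s)^-1.
have c0 : 0 < c by rewrite invr_gt0 mulr_gt0.
have dB x : 0 < x < b ->
    is_derive x (1:R) (fun x => b `^ sigma - x `^ sigma) (- (sigma * x `^ (sigma - 1))).
  move=> /andP[x0 xb]; rewrite -[X in is_derive _ _ _ X]add0r.
  by apply: is_deriveB; exact: is_derive1_powR.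
apply: (@ge0_integral_oo_fin _ _ (fun x => - c * (b `^ sigma - x `^ sigma) `^ s) _ _
  (c * (b `^ sigma) `^ s)) => //.
- by move=> x _; rewrite mulr_ge0 ?powR_ge0.
- move=> x xb; case/andP: (xb) => x0 _; apply: continuousM.
    exact: continuous_powR_gt0.
  apply: (@continuous_comp _ _ _ (fun x => b `^ sigma - x `^ sigma) (@powR R ^~ al)).
    by apply: continuousB; [exact: cst_continuous|exact: continuous_powR_gt0].
  by apply: continuous_powR_gt0; rewrite subr_gt0; case/andP: (powR_itv _ xb).
- move=> x xb; have Bx : 0 < b `^ sigma - x `^ sigma.
    by rewrite subr_gt0; case/andP: (powR_itv _ xb).
  rewrite (_ : _ * _ = - c *: (s * (b `^ sigma - x `^ sigma) `^ (s - 1) *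
      - (sigma * x `^ (sigma - 1)))); last first.
    rewrite /s addrK -/s /c /GRing.scale/=.
    by field; rewrite !gt_eqF.
  apply: is_deriveZ.
  apply: (@is_derive1_comp _ (@powR R ^~ s) (fun x => b `^ sigma - x `^ sigma)).
    exact: is_derive1_powR.
  exact: dB.
- move=> x xb; rewrite mulNr normrN ger0_norm; last by rewrite mulr_ge0 ?powR_ge0// ltW.
  case/andP: (powR_itv _ xb) => y0 yB.
  rewrite ler_pM2l// ge0_ler_powR ?nnegrE ?subr_ge0 ?powR_ge0 ?(ltW s0) ?(ltW yB)//.
  by rewrite lerBlDr lerDl ltW.
Qed.

Lemma integral_jacobi_weight_fin :
  (\int[lebesgue_measure]_(x in `]0%R, b[) (jacobi_weight x)%:E < +oo)%E.
Proof.
have [K [K0 HK]] := @beta_weight_le _ (b `^ sigma) be al (powR_gt0 _ hb).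
have m1 : measurable_fun `]0%R, b[ (fun x : R => (x `^ (sigma * (be + 1) - 1))%:E).
  by apply/measurable_EFinP; exact: measurable_funTS.
have m2 : measurable_fun `]0%R, b[
    (fun x : R => (x `^ (sigma - 1) * (b `^ sigma - x `^ sigma) `^ al)%:E).
  apply/measurable_EFinP; apply: measurable_funTS; apply: measurable_funM => //.
  by apply: (measurableT_comp (measurable_powR _)); exact: measurable_funB.
pose h x := (K%:E * ((x `^ (sigma * (be + 1) - 1))%:E +
  (x `^ (sigma - 1) * (b `^ sigma - x `^ sigma) `^ al)%:E))%E.
apply: (@le_lt_trans _ _ (\int[lebesgue_measure]_(x in `]0%R, b[) h x)%E).
  apply: ge0_le_integral => //.
  - by move=> x _; rewrite lee_fin jacobi_weight_ge0.
  - by apply/measurable_EFinP; exact: measurable_jacobi_weight.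
  - by apply: emeasurable_funM => //; exact: emeasurable_funD.
  move=> x; rewrite /= in_itv/= => xb; case/andP: (xb) => x0 _.
  rewrite /h -EFinD -EFinM lee_fin /jacobi_weight.
  rewrite (_ : _ `^ (sigma * _ - 1) = x `^ (sigma - 1) * (x `^ sigma) `^ be); last first.
    rewrite -powRrM -powRD; first by congr (_ `^ _); ring.
    by rewrite (gt_eqF x0) implybT.
  rewrite -mulrDr [leRHS]mulrCA; apply: ler_wpM2l; first exact: powR_ge0.
  exact/HK/powR_itv.
rewrite ge0_integralZl//; last 2 first.
- exact: emeasurable_funD.
- by move=> x _; rewrite adde_ge0// lee_fin ?mulr_ge0 ?powR_ge0.
rewrite ge0_integralD//; last 2 first.
- by move=> x _; rewrite lee_fin powR_ge0.
- by move=> x _; rewrite lee_fin mulr_ge0 ?powR_ge0.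
by rewrite lte_mul_pinfty ?lee_fin// lte_add_pinfty.
Qed.
End JacobiWeight.

(** * Jacobi polynomials as a basis of the polynomials *)

Section JacobiPoly.
Context {R : realType} (al be : R).

(** The variable is [y = (z + 1) / 2], which turns [(z - 1) / 2] into [y - 1] and matches
    [y = (x / b)^sigma]. *)
Definition jacobi_poly (n : nat) : {poly R} :=
  \sum_(s < n.+1) (gbinom (n%:R + al) (n - s) * gbinom (n%:R + be) s)
    *: (('X - 1) ^+ s * 'X ^+ (n - s)).

Lemma horner_jacobi_poly n y :
  (jacobi_poly n).[y] = jacobiP al be n (2 * y - 1).
Proof.
rewrite /jacobi_poly /jacobiP horner_sum; apply: eq_bigr => s _.
rewrite hornerZ hornerM !horner_exp hornerXsubC hornerX -mulrA.
by congr (_ * (_ ^+ _ * _ ^+ _)); field.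
Qed.

Hypotheses (hal : -1 < al) (hbe : -1 < be).

(** Each factor [n + a - i] with [i < m <= n] is at least [1 + a > 0]. *)
Lemma gbinom_gt0 (a : R) (n m : nat) : -1 < a -> (m <= n)%N -> 0 < gbinom (n%:R + a) m.
Proof.
move=> a1 mn; rewrite /gbinom divr_gt0 ?ltr0n ?fact_gt0//.
apply: prodr_gt0 => i _.
have : i.+1%:R <= n%:R :> R by rewrite ler_nat (leq_trans (ltn_ord i)).
by rewrite -natr1; lra.
Qed.

(* The coefficient of ['X^n] is a sum of positive terms. *)
Lemma size_jacobi_poly n : size (jacobi_poly n) = n.+1.
Proof.
have mon (s : 'I_n.+1) : ('X - 1) ^+ s * 'X ^+ (n - s) \is @monic R.
  by rewrite rpredM ?rpredX ?monicXsubC ?monicX.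
have sz (s : 'I_n.+1) : size (('X - 1) ^+ s * 'X ^+ (n - s) : {poly R}) = n.+1.
  rewrite size_monicM ?rpredX ?monicXsubC// ?monic_neq0 ?monicXn//.
  by rewrite size_exp_XsubC size_polyXn addnS /= addSn subnKC// -ltnS.
apply/eqP; rewrite eqn_leq; apply/andP; split.
  apply: leq_trans (size_sum _ _ _) _; apply/bigmax_leqP => s _.
  by apply: leq_trans (size_scale_leq _ _) _; rewrite sz.
rewrite ltnNge; apply/negP => /leq_sizeP /(_ n (leqnn n)) /eqP; apply/negP.
rewrite coef_sum gt_eqF//.
have cf (s : 'I_n.+1) : ((('X - 1) ^+ s * 'X ^+ (n - s)) : {poly R})`_n = 1.
  by have /monicP := mon s; rewrite lead_coefE sz.
under eq_bigr do rewrite coefZ cf mulr1.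
rewrite big_ord_recl; apply: ltr_wpDr; last first.
  by rewrite mulr_gt0 ?gbinom_gt0 ?leq_subr.
apply: sumr_ge0 => s _.
by rewrite ltW// mulr_gt0 ?gbinom_gt0 ?leq_subr// -ltnS ltn_ord.
Qed.
End JacobiPoly.

(** Triangular elimination: a multiple of [q n] cancels the coefficient of degree [n]. *)
Lemma poly_span (F : fieldType) (q : nat -> {poly F}) :
  (forall n, size (q n) = n.+1) ->
  forall (n : nat) (p : {poly F}), (size p <= n)%N ->
    exists c : nat -> F, p = \sum_(k < n) c k *: q k.
Proof.
move=> sq; elim=> [p|n IHn p pn].
  by rewrite leqn0 size_poly_eq0 => /eqP ->; exists (fun=> 0); rewrite big_ord0.
have qn0 : (q n)`_n != 0.
  have -> : (q n)`_n = lead_coef (q n) by rewrite lead_coefE sq.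
  by rewrite lead_coef_eq0 -size_poly_eq0 sq.
pose a := p`_n / (q n)`_n.
have [|c pc] := IHn (p - a *: q n).
  apply/leq_sizeP => j; rewrite leq_eqVlt => /orP[/eqP <-|nj].
    by rewrite coefB coefZ /a divfK// subrr.
  rewrite coefB coefZ (nth_default 0 (leq_trans pn nj)).
  by rewrite (@nth_default _ 0 (q n)) ?sq// mulr0 subr0.
exists (fun k => if k == n then a else c k).
rewrite big_ord_recr/= eqxx -[LHS](subrK (a *: q n)) pc; congr (_ + _).
by apply: eq_bigr => i _; rewrite (ltn_eqF (ltn_ord i)).
Qed.

(** * Density of the polynomials in [t] *)

Lemma poly_approx_step d (T : measurableType d) (R : realType)
    (mu : {measure set T -> \bar R}) (D : set T) (rho t : T -> R) (c : R) :
  measurable D -> measurable_fun D rho -> (forall x, D x -> 0 <= rho x) ->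
  (\int[mu]_(x in D) (rho x)%:E < +oo)%E ->
  measurable_fun D t -> (forall x, D x -> 0 <= t x <= 1) -> 0 < c ->
  poly_approx mu D rho t (fun x => (t x < c)%R%:R).
Proof.
move=> mD mrho rho0 rhooo mt t01 c0.
pose p n : {poly R} := (1 - 'X^n) ^+ Num.truncn (n%:R / c ^+ n : R).
have pE n x : (p n).[t x] = (1 - t x ^+ n) ^+ Num.truncn (n%:R / c ^+ n : R).
  by rewrite /p !hornerE.
apply: (poly_approx_lim1 _ _ _ _ _ _ _ _ _ (fun n x => (p n).[t x])) => //.
- by move=> n; exact: measurable_horner_comp.
- have mlt := @measurable_fun_ltr _ _ _ D t (cst c) mt (@measurable_cst _ _ _ _ _ c).
  by apply: (measurableT_comp _ mlt (f := fun b : bool => (b%:R : R))).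
- move=> n x Dx; rewrite pE; case/andP: (t01 x Dx) => t0 t1.
  by rewrite exprn_ge0 ?exprn_ile1 ?subr_ge0 ?exprn_ile1// lerBlDr lerDl exprn_ge0.
- by move=> x _; rewrite ler0n lern1 leq_b1.
- by move=> x Dx; under eq_fun do rewrite pE; apply: cvg_step_poly => //; exact: t01.
- by move=> n; exact: poly_approx_poly.
Qed.

(** The rays []-oo, c[] form a pi-system generating the Borel sets; as [t] is increasing, [x < c]
    becomes [t x < t c], a step in [t]. *)
Lemma poly_approx_itv (R : realType) (b : R) (rho t f : R -> R) :
  measurable_fun `]0, b[ rho -> (forall x, 0 <= rho x) ->
  (\int[lebesgue_measure]_(x in `]0%R, b[) (rho x)%:E < +oo)%E ->
  measurable_fun `]0, b[ t ->
  {in `]0, b[, forall x, 0 < t x <= 1} ->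
  {in `]0, b[ &, {mono t : x y / x < y}} ->
  measurable_fun `]0, b[ f ->
  (wsq lebesgue_measure `]0%R, b[ rho f < +oo)%E ->
  poly_approx lebesgue_measure `]0, b[ rho t f.
Proof.
move=> mrho rho0 rhooo mt t01 tmono mf foo.
have t01' x : (`]0, b[%classic : set R) x -> 0 <= t x <= 1.
  by move=> /t01/andP[/ltW -> ->].
have rho0' x : (`]0, b[%classic : set R) x -> 0 <= rho x by [].
suff ind A : measurable A -> poly_approx lebesgue_measure `]0, b[ rho t \1_A.
  exact: poly_approx_L2.
move: A; refine (@poly_approx_indic_gen _ _ R lebesgue_measure `]0, b[%classic
  rho t _ _ _ _ _ (@RGenInftyO.G R) _ _ _) => //.
- exact: RGenInftyO.measurableE.
- move=> _ _ [x ->] [y ->]; exists (Num.min x y).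
  by apply/seteqP; split => z; rewrite /= !in_itv/= lt_min => /andP.
- move=> _ [c ->].
  (* For [c] outside the interval the indicator is the constant 0 or 1 there. *)
  have [c0|c0] := leP c 0.
    apply: poly_approx_eq (poly_approx_poly _ _ _ _ 0) => x /set_mem.
    rewrite /= in_itv/= => /andP[x0 _].
    by rewrite horner0 indicE memNset//= in_itv/= ltNge (le_trans c0 (ltW x0)).
  have [bc|cb] := leP b c.
    apply: poly_approx_eq (poly_approx_poly _ _ _ _ 1) => x /set_mem.
    rewrite /= in_itv/= => /andP[_ xb].
    by rewrite hornerE indicE mem_set//= in_itv/= (lt_le_trans xb).
  have cI : c \in `]0, b[ by rewrite in_itv/= c0.
  refine (@poly_approx_eq _ _ R lebesgue_measure _ rho t (fun x => (t x < t c)%R%:R) _ _ _).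
    by move=> x /set_mem /= xI; rewrite tmono// indicE mem_setE in_itv.
  apply: poly_approx_step => //.
  by case/andP: (t01 _ cI).
Qed.

Lemma horner_bounded (R : realDomainType) (p : {poly R}) :
  exists M, 0 <= M /\ forall y, 0 <= y <= 1 -> `|p.[y]| <= M.
Proof.
elim/poly_ind: p => [|p c [M [M0 pM]]].
  by exists 0; split => // y _; rewrite horner0 normr0.
exists (M + `|c|); split => [|y y01]; first exact: addr_ge0.
rewrite hornerMXaddC (le_trans (ler_normD _ _))// lerD2r normrM.
case/andP: (y01) => y0 y1; rewrite (ger0_norm y0).
by apply: le_trans (pM y y01); rewrite ler_piMr.
Qed.

(** * Completeness of the two systems *)

(** Multiplication by [h], the inverse of [g] on the open interval, carries the norm with weight [w]
    to the one with the Jacobi weight, and [J n] to a polynomial of degree [n] in [t]. *)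
Lemma complete_in_jacobi (R : realType) (b sigma al be : R) (g h w : R -> R)
    (J : nat -> R -> R) :
  0 < b -> 0 < sigma -> -1 < al -> -1 < be ->
  measurable_fun setT g -> measurable_fun setT h -> measurable_fun setT w ->
  (forall x, 0 < x < b -> h x * g x = 1) ->
  (forall x, 0 < x < b -> g x ^+ 2 * w x = jacobi_weight b sigma al be x) ->
  (forall n x, J n x = g x * jacobiP al be n (2 * (x / b) `^ sigma - 1)) ->
  complete_in b w J.
Proof.
move=> hb hsigma hal hbe mg mh mw hg gw JE.
pose t x := (x / b) `^ sigma.
have mt : measurable_fun setT t.
  by apply: (measurableT_comp (measurable_powR _)); exact: measurable_funM.
have t01 : {in `]0, b[, forall x, 0 < t x <= 1}.
  move=> x; rewrite in_itv/= => /andP[x0 xb].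
  rewrite powR_gt0 ?divr_gt0//=; apply: (@le_trans _ _ (1 `^ sigma)); last by rewrite powR1.
  by rewrite ge0_ler_powR ?nnegrE ?divr_ge0 ?(ltW x0) ?(ltW hb) ?(ltW hsigma)//
     ler_pdivrMr// mul1r ltW.
have tmono : {in `]0, b[ &, {mono t : x y / x < y}}.
  have tinc : {in `]0, b[ &, {homo t : x y / x < y}}.
    move=> x y; rewrite !in_itv/= => /andP[x0 xb] /andP[y0 yb] xy.
    by rewrite gt0_ltr_powR ?nnegrE ?divr_ge0 ?(ltW x0) ?(ltW y0) ?(ltW hb)// ltr_pM2r// invr_gt0.
  exact: leW_mono_in (le_mono_in tinc).
have JpE n x : J n x = g x * (jacobi_poly al be n).[t x].
  by rewrite JE horner_jacobi_poly.
have mrho := @measurable_jacobi_weight R b sigma al be.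
have rhooo := @integral_jacobi_weight_fin R b sigma al be hb hsigma hal hbe.
have mp (p : {poly R}) D : measurable_fun D (fun x => p.[t x]).
  by apply: measurable_horner_comp; exact: measurable_funTS.
have mJ n : measurable_fun setT (J n).
  by rewrite (_ : J n = fun x => g x * (jacobi_poly al be n).[t x]);
    [exact: measurable_funM|apply/funext => x].
have mhu (u : R -> R) : measurable_fun `]0, b[ u -> measurable_fun `]0, b[ (fun x => h x * u x).
  by move=> mu; apply: measurable_funM => //; exact: measurable_funTS.
have int_oo (u : R -> R) : measurable_fun `]0, b[ u ->
    (\int[lebesgue_measure]_(x in itv0b b) (u x ^+ 2 * w x)%:E)%E =
    wsq lebesgue_measure `]0%R, b[ (jacobi_weight b sigma al be) (fun x => h x * u x).
  (* The endpoints form a null set, so the default values of powers at 0 do not affect the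
     integral. *)
  move=> mu; rewrite /itv0b integral_itv_bndoo; last first.
    apply/measurable_EFinP; apply: measurable_funM; last exact: measurable_funTS.
    exact: measurable_funX.
  apply: eq_integral => x /set_mem; rewrite /= in_itv/= => xb.
  by rewrite -gw// mulrA -exprMn [h x * u x * g x]mulrAC hg// mul1r.
have sub : `]0, b[ `<=` itv0b b by exact: subset_itv_oo_cc.
split=> [n|u [mu uoo] eps eps0].
  split; first exact: measurable_funTS.
  have mJn : measurable_fun `]0, b[ (J n) by exact: measurable_funTS.
  (* [h * J n] is a polynomial in [t], hence bounded on the interval, and the weight has finite
     integral. *)
  rewrite int_oo//; have [M [M0 pM]] := @horner_bounded R (jacobi_poly al be n).
  apply: le_lt_trans (wsq_cst_fin _ _ _ _ _ _ rhooo M) => //.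
  - apply: ge0_le_integral => //.
    + by move=> x _; rewrite lee_fin mulr_ge0 ?sqr_ge0 ?jacobi_weight_ge0.
    + apply/measurable_EFinP; apply: measurable_funM; last exact: mrho.
      by apply: measurable_funX; exact: mhu.
    + apply/measurable_EFinP; apply: measurable_funM; last exact: mrho.
      by apply: measurable_funX; exact: measurable_cst.
    move=> x /= xI; rewrite lee_fin ler_wpM2r ?jacobi_weight_ge0//.
    have xb : 0 < x < b by move: xI; rewrite in_itv.
    rewrite JpE mulrA hg// mul1r -(real_normK (num_real _)).
    have /andP[t0 t1] := t01 x xI.
    by rewrite lerXn2r ?nnegrE// pM// (ltW t0).
  - exact: mrho.
  - by move=> x _; exact: jacobi_weight_ge0.
have mu' : measurable_fun `]0, b[ u.
  by apply: (@measurable_funS _ _ _ _ (itv0b b)) => //; exact: measurable_itv.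
have [|p pu] := @poly_approx_itv R b (jacobi_weight b sigma al be) t (fun x => h x * u x)
  (mrho _) (@jacobi_weight_ge0 R b sigma al be) rhooo (measurable_funTS mt) t01 tmono (mhu u mu') _ eps eps0.
  by rewrite -int_oo.
(* The coefficients sought are those of [p] in the Jacobi basis. *)
have [c pc] := poly_span _ _ (size_jacobi_poly al be hal hbe) _ p (leqnn _).
exists (size p), c.
rewrite int_oo; last first.
  apply: measurable_funB => //.
  by apply: measurable_sum => k; apply: measurable_funM => //; exact: measurable_funTS.
congr (_ < _)%E: pu; apply: eq_integral => x /set_mem; rewrite /= in_itv/= => xb.
congr (_ ^+ 2 * _)%:E; rewrite mulrBr; congr (_ - _).
rewrite {1}pc horner_sum mulr_sumr; apply: eq_bigr => k _.
by rewrite hornerZ JpE [RHS]mulrCA [h x * _]mulrA hg// mul1r.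
Qed.

Theorem theorem3p5 (R : realType) (b sigma al be mu eta : R)
  (hb : 0 < b) (hsigma : 0 < sigma) (hal : -1 < al) (hbe : -1 < be) :
  let J1 := fun (n : nat) (x : R) =>
    x `^ (sigma * (be - eta - mu)) * jacobiP al be n (2 * (x / b) `^ sigma - 1) in
  let J2 := fun (n : nat) (x : R) =>
    x `^ (sigma * eta) * (b `^ sigma - x `^ sigma) `^ al
      * jacobiP al be n (2 * (x / b) `^ sigma - 1) in
  let w1 := fun x : R =>
    x `^ (sigma * (2 * (eta + mu) - be)) * (b `^ sigma - x `^ sigma) `^ al in
  let w2 := fun x : R =>
    x `^ (sigma * (be - 2 * eta)) * (b `^ sigma - x `^ sigma) `^ (- al) in
  complete_in b (fun x => x `^ (sigma - 1) * w1 x) J1 /\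
  complete_in b (fun x => x `^ (sigma - 1) * w2 x) J2.
Proof.
move=> J1 J2 w1 w2.
have mB e : measurable_fun setT (fun x : R => (b `^ sigma - x `^ sigma) `^ e).
  by apply: (measurableT_comp (measurable_powR _)); exact: measurable_funB.
have B0 x : 0 < x < b -> 0 < b `^ sigma - x `^ sigma.
  by move=> /andP[x0 xb]; rewrite subr_gt0 gt0_ltr_powR ?nnegrE ?ltW.
have powV (y e : R) : 0 < y -> y `^ (- e) * y `^ e = 1.
  by move=> y0; rewrite powRN mulVf// gt_eqF// powR_gt0.
have powX (y e e' : R) : 0 < y -> (y `^ e) ^+ 2 * y `^ e' = y `^ (e + e + e').
  by move=> y0; rewrite expr2 !powRD ?(gt_eqF y0) ?implybT.
split.
- apply: (@complete_in_jacobi _ _ sigma al be (fun x => x `^ (sigma * (be - eta - mu)))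
    (fun x => x `^ (- (sigma * (be - eta - mu))))) => //.
  + by apply: measurable_funM => //; exact: measurable_funM.
  + by move=> x /andP[x0 _]; exact: powV.
  (* The exponents of [x] add up: [2 sigma (be - eta - mu) + sigma (2 (eta + mu) - be) = sigma
     be]. *)
  + move=> x /andP[x0 _]; rewrite /w1 /jacobi_weight mulrCA; congr (_ * _).
    rewrite mulrA powX// -powRrM; congr (_ `^ _ * _); ring.
- apply: (@complete_in_jacobi _ _ sigma al be
    (fun x => x `^ (sigma * eta) * (b `^ sigma - x `^ sigma) `^ al)
    (fun x => x `^ (- (sigma * eta)) * (b `^ sigma - x `^ sigma) `^ (- al))) => //.
  + exact: measurable_funM.
  + exact: measurable_funM.
  + by apply: measurable_funM => //; exact: measurable_funM.
  + move=> x xb; have Bx := B0 x xb; case/andP: xb => x0 _.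
    by rewrite mulrACA !powV// mulr1.
  (* Here [2 sigma eta + sigma (be - 2 eta) = sigma be] and [2 al - al = al]. *)
  + move=> x xb; have Bx := B0 x xb; case/andP: xb => x0 _.
    rewrite /w2 /jacobi_weight mulrCA; congr (_ * _).
    rewrite exprMn mulrACA !powX// -powRrM.
    by congr (_ `^ _ * _ `^ _); ring.
Qed.
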